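(* Let $X$ be a separable infinite-dimensional Banach space, let $T$ be a bounded linear operator on $X$ and let $a\in\mathcal{S}$. If $T$ is $\mathcal{U}$-frequently hypercyclic with respect to $a$, then for any $n\geq1$, the $n$-fold product $T\times\cdots\times T$ is $\mathcal{U}$-frequently hypercyclic with respect to $a$.
   Context: $\mathbb{N}=\{0,1,2,\dots\}$. For a non-decreasing sequence $a=(a_n)_{n\in\mathbb{N}}$ of non-negative real numbers put $v_n(a)=\dfrac{a_n}{\sum_{j=0}^{n-1}a_j}$, considered only for those $n$ with $\sum_{j=0}^{n-1}a_j>0$. The class $\mathcal{S}$ is the set of all sequences $a=(a_n)_{n\in\mathbb{N}}$ of non-negative reals such that $(a_n)$ is non-decreasing, $a_n\to+\infty$, $(v_n(a))$ is non-increasing and $v_n(a)\to 0$. For $A\subseteq\mathbb{N}$ and $a\in\mathcal S$, the upper $a$-density is $\overline{d}_a(A)=\limsup_{N\to+\infty}\frac{\sum_{j=0}^{N}a_j\mathbf{1}_A(j)}{\sum_{j=0}^{N}a_j}$, where $\mathbf 1_A$ is the indicator function of $A$. A bounded operator $S$ on a Banach space $Y$ is $\mathcal{U}$-frequently hypercyclic with respect to $a$ if there is $y\in Y$ such that $\overline{d}_a(\{n\in\mathbb{N}:S^ny\in U\})>0$ for every non-empty open set $U\subseteq Y$. The $n$-fold product $T\times\cdots\times T$ is the operator $(x_1,\dots,x_n)\mapsto(Tx_1,\dots,Tx_n)$ on $X^n$ (product topology). *)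

(* Defs.v *)
From HB Require Import structures.
From mathcomp Require Import all_boot all_order all_algebra.
From mathcomp Require Import complex.
From mathcomp Require Import all_classical all_reals all_analysis.
Set Implicit Arguments.
Unset Strict Implicit.
Unset Printing Implicit Defensive.
Import Order.TTheory GRing.Theory Num.Theory.
Import numFieldNormedType.Exports.
Local Open Scope classical_set_scope.
Local Open Scope ring_scope.

(* [v_seq a n] is meaningful only when the denominator is positive; elsewhere it
   is [a n / 0 = 0]. *)
Definition v_seq (R : realType) (a : nat -> R) (n : nat) : R :=
  a n / \sum_(j < n) a j.

(* The domain condition [0 < \sum_(j < n) a j] is put only in the monotonicity
   clause: as [a] is non-decreasing and tends to infinity, it holds for all
   large [n], so it does not affect the limit of [v_seq a]. Monotonicity on the
   domain needs it only at the smaller index, the partial sums of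
   non-negative terms being non-decreasing. *)
Definition class_S (R : realType) (a : nat -> R) : Prop :=
  [/\ forall n, 0 <= a n,
      {homo a : m n / (m <= n)%N >-> m <= n},
      a n @[n --> \oo] --> +oo,
      forall m n : nat, 0 < \sum_(j < m) a j -> (m <= n)%N -> v_seq a n <= v_seq a m
    & v_seq a n @[n --> \oo] --> (0 : R)].

Definition upper_density (R : realType) (a : nat -> R) (A : set nat) : \bar R :=
  limn_esup (fun N : nat =>
    ((\sum_(j < N.+1) a j * \1_A (val j)) / \sum_(j < N.+1) a j)%:E).

(* Only the topology of the space and the underlying map of the operator enter
   the definition. *)
Definition U_frequently_hypercyclic (R : realType) (a : nat -> R)
    (Y : topologicalType) (S : Y -> Y) : Prop :=
  exists y : Y, forall U : set Y, open U -> U !=set0 ->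
    (0 < upper_density a [set n | U (iter n S y)])%E.

Definition separable (Y : topologicalType) : Prop :=
  exists D : set Y, countable D /\ dense D.

Definition infinite_dimensional (K : numFieldType) (X : lmodType K) : Prop :=
  ~ exists (m : nat) (e : 'I_m -> X),
      forall x : X, exists c : 'I_m -> K, x = \sum_(i < m) c i *: e i.

(* A Banach space is taken over the real or over the complex numbers. *)
Definition real_or_complex (R : realType) (K : numFieldType) : Prop :=
  K = R :> numFieldType \/ K = R[i] :> numFieldType.

Definition product_operator (X : Type) (n : nat) (T : X -> X)
    (x : {ptws 'I_n -> X}) : {ptws 'I_n -> X} :=
  fun i => T (x i).

(* Main.v *)
Require Import Defs.
From HB Require Import structures.
From mathcomp Require Import all_boot all_order all_algebra.
From mathcomp Require Import complex.
From mathcomp Require Import all_classical all_reals all_analysis.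
From mathcomp Require Import zify lra.
Set Implicit Arguments.
Unset Strict Implicit.
Unset Printing Implicit Defensive.
Import Order.TTheory GRing.Theory Num.Theory.
Import numFieldNormedType.Exports.
Local Open Scope classical_set_scope.
Local Open Scope ring_scope.

(** Let [x] be a vector whose orbit under [T] visits every non-empty open set with
    positive upper density. The product has such a vector by a Baire category
    argument, provided that for every box [U] there is a bound [c > 0] such that
    every other box [V] contains a point whose orbit has spent, at arbitrarily
    late times, a weighted proportion more than [c] of its life in [U]
    ([product_often_above]). The point is that [c] must not depend on [V].

    The points in question have all their coordinates on the orbit of [x]. The
    orbit of [(T^i_1 x, ..., T^i_n x)] is in a box at time [p] when [p] belongs
    to certain translates, by the numbers [i_l], of sets of visit times of [x].
    Intersections of translates of a set of positive density may well have
    density zero, but among sufficiently many translates, as many as the density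
    dictates, some [n] have an intersection whose density is bounded below
    ([often_above_translates]). It thus suffices to offer to this pigeonhole
    principle a long list of times at which the sets to be reached can be
    visited in any order, whichever [n] of these times are selected afterwards
    ([colored_times]).

    Such lists exist because [T] is weakly mixing of all orders
    ([common_transit_time]). This follows, by linearity, from the existence of a
    common time [k] at which [T^k] takes a point near [x] to a point near [0] and a
    point near [0] to a point near [x] ([return_through_zero]). To find [k], the
    case of two translates of the pigeonhole principle shows that the
    differences of visit times meet the gaps of any long sequence, and the gaps
    can be chosen among transit times from [0] to [x], because points close to
    [0] stay close to [0] for a long time.

    The only property of the weights that matters for translates is that
    translating a set by one lowers its weighted means by at most [v_n(a)], which
    tends to zero ([weighted_mean_shift]). *)

(** * Weighted means and densities *)

Definition weighted_mean (R : realType) (a f : nat -> R) (N : nat) : R :=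
  (\sum_(j < N.+1) a j * f (val j)) / \sum_(j < N.+1) a j.

(** For [d > 0] this is a quantitative form of positive upper density. It keeps
    an explicit lower bound, which must not depend on the open sets that arise
    later in the category argument. *)
Definition often_above (R : realType) (a : nat -> R) (A : set nat) (d : R) :=
  forall N0 : nat, exists N : nat,
    (N0 <= N)%N /\ d < weighted_mean a \1_A N.

Lemma upper_density_gt0P (R : realType) (a : nat -> R) (A : set nat) :
  (0 < upper_density a A)%E <-> exists2 d : R, 0 < d & often_above a A d.
Proof.
rewrite /upper_density /limn_esup /limf_esup; set f := (fun N : nat => _%:E).
set E := (X in ereal_inf X); split.
  move=> E0.
  have [d d0 dE] : exists2 d : R, 0 < d & (d%:E < ereal_inf E)%E.
    case: (ereal_inf E) E0 => [r| |] //.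
      rewrite lte_fin => r0; exists (r / 2); first by rewrite divr_gt0.
      by rewrite lte_fin; lra.
    by exists 1 => //; rewrite ltry.
  exists d => // N0.
  have : (d%:E < ereal_sup (f @` [set N | (N0 <= N)%N]))%E.
    apply: (lt_le_trans dE); apply: ereal_inf_lbound.
    by exists [set N | (N0 <= N)%N] => //; exists N0.
  case/ereal_sup_gt => _ [N /= leN <-]; rewrite lte_fin => dN.
  by exists N; split.
case=> d d0 dA; apply: (@lt_le_trans _ _ d%:E); first by rewrite lte_fin.
apply: le_ereal_inf_tmp => _ [B [N0 _ NB] <-].
have [N [leN dN]] := dA N0.
apply: (@le_trans _ _ (f N)); first by rewrite lee_fin ltW.
by apply: ereal_sup_ubound; exists N => //; apply: NB.
Qed.

Lemma weighted_mean_sum (R : realType) (a : nat -> R) (I : finType) (P : pred I)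
    (f : I -> nat -> R) N :
  weighted_mean a (fun p => \sum_(i | P i) f i p) N =
  \sum_(i | P i) weighted_mean a (f i) N.
Proof.
rewrite /weighted_mean -[RHS]mulr_suml; congr (_ / _).
by rewrite [RHS]exchange_big; apply: eq_bigr => j _; rewrite mulr_sumr.
Qed.

Lemma le_weighted_mean (R : realType) (a f g : nat -> R) N :
  (forall j, 0 <= a j) -> (forall j, (j <= N)%N -> f j <= g j) ->
  weighted_mean a f N <= weighted_mean a g N.
Proof.
move=> a0 fg; apply: ler_wpM2r; first by rewrite invr_ge0 sumr_ge0.
by apply: ler_sum => j _; apply: ler_wpM2l => //; apply: fg; rewrite -ltnS ltn_ord.
Qed.

Lemma indicE01 (R : realType) (A : set nat) p :
  \1_A p = (if `[< A p >] then 1 else 0) :> R.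
Proof. by rewrite indicE; case: asboolP => h; [rewrite mem_set|rewrite memNset]. Qed.

Lemma le_weighted_mean_indic (R : realType) (a : nat -> R) (A B : set nat) N :
  (forall j, 0 <= a j) -> (forall j, (j <= N)%N -> A j -> B j) ->
  weighted_mean a \1_A N <= weighted_mean a \1_B N.
Proof.
move=> a_ge0 AB; apply: le_weighted_mean => // j jN; rewrite !indicE01.
case: asboolP => [Aj|_]; first by rewrite asboolT //; exact: AB.
by case: asboolP.
Qed.

Section ClassS.
Variables (R : realType) (a : nat -> R).
Hypothesis Sa : class_S a.

Let a_ge0 n : 0 <= a n. Proof. by case: Sa. Qed.
Let a_homo : {homo a : m n / (m <= n)%N >-> m <= n}. Proof. by case: Sa. Qed.

Lemma psum_gt0_near : \forall N \near \oo, 0 < \sum_(j < N) a j.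
Proof.
case: Sa => _ _ /cvgryPgt /(_ 0) [N0 _ aN0] _ _.
exists N0.+1 => // N /= leN.
have aN0_gt0 : 0 < a N0 by apply: aN0 => /=.
by rewrite (bigD1 (Ordinal leN)) //= ltr_wpDr // sumr_ge0.
Qed.

(** Shifting [A] by one changes each weight [a j] into [a j.-1]; as [a] is
    non-decreasing these changes telescope to at most [a N], whence one
    [v_seq a N] per unit of shift, uniformly in [A]. *)
Lemma weighted_mean_shift k N (A : set nat) : 0 < \sum_(j < N) a j ->
  weighted_mean a \1_A N <=
  weighted_mean a \1_[set p | A (p + k)%N] N + v_seq a N *+ k.
Proof.
move=> S0; have S1 : 0 < \sum_(j < N.+1) a j.
  by rewrite big_ord_recr /= ltr_wpDr.
elim: k => [|k IHk].
  rewrite mulr0n addr0 (_ : [set p | _] = A) //.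
  by apply/seteqP; split=> p /=; rewrite addn0.
apply: (le_trans IHk); rewrite mulrSr [_ *+ k + _]addrC addrA lerD2r.
set B := [set p | A (p + k)%N]; rewrite (_ : [set p | _] = [set p | B p.+1]); last first.
  by apply/seteqP; split=> p /=; rewrite /B /= addSnnS.
apply: (@le_trans _ _ (a N / (\sum_(j < N.+1) a j) +
                       weighted_mean a \1_[set p | B p.+1] N)); last first.
  rewrite [leLHS]addrC lerD2l ler_wpM2l // lef_pV2 ?posrE //.
  by rewrite big_ord_recr /= lerDl.
rewrite /weighted_mean -mulrDl ler_wpM2r ?invr_ge0 ?(ltW S1) //.
(* The term [a n] pays for the increments of the weights up to [n]. *)
have tele n : \sum_(j < n.+1) a j * \1_B (val j) <=
    a n + \sum_(j < n) a j * \1_[set p | B p.+1] (val j).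
  elim: n => [|n IHn].
    rewrite big_ord1 big_ord0 addr0 /= indicE01.
    by case: asboolP; rewrite ?mulr1 ?mulr0.
  rewrite big_ord_recr [X in _ <= _ + X]big_ord_recr /=.
  have := a_homo (leqnSn n); rewrite !indicE01 /=.
  by case: asboolP => _; lra.
rewrite (le_trans (tele N)) // lerD2l [leRHS]big_ord_recr /= lerDl.
by rewrite mulr_ge0 // indicE.
Qed.

Lemma weighted_mean_shift_near k (e : R) : 0 < e ->
  \forall N \near \oo, forall A : set nat,
    weighted_mean a \1_A N < weighted_mean a \1_[set p | A (p + k)%N] N + e.
Proof.
move=> e0; case: (Sa) => _ _ _ _ /cvgr_lt v0.
have ek0 : 0 < e / k.+1%:R by rewrite divr_gt0.
near=> N => A; have S0 : 0 < \sum_(j < N) a j by near: N; exact: psum_gt0_near.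
rewrite (le_lt_trans (weighted_mean_shift k A S0)) // ltrD2l.
have vN : v_seq a N < e / k.+1%:R by near: N; exact: v0.
have v_ge0 : 0 <= v_seq a N by rewrite divr_ge0 // ltW.
rewrite ltr_pdivlMr // mulr_natr in vN; apply: le_lt_trans vN.
by rewrite mulrS lerDr.
Unshelve. all: by end_near. Qed.

Lemma often_above_shift k (A : set nat) (c d : R) : c < d ->
  often_above a A d -> often_above a [set p | A (p + k)%N] c.
Proof.
move=> cd dA N0.
have /(weighted_mean_shift_near k) [N1 _ N1P] : 0 < d - c by rewrite subr_gt0.
have [N [leN dN]] := dA (maxn N0 N1); move: leN; rewrite geq_max => /andP[N0N N1N].
by exists N; split => //; have := N1P _ N1N A; lra.
Qed.

Lemma often_above_nonempty (A : set nat) (d : R) : 0 < d ->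
  often_above a A d -> A !=set0.
Proof.
move=> d0 /(_ 0%N) [N [_ dN]]; apply/set0P/eqP => A0; move: dN.
rewrite A0 /weighted_mean big1 ?mul0r ?ltNge ?ltW // => j _.
by rewrite indic0 mulr0.
Qed.

Lemma often_above_unbounded (A : set nat) (d : R) k : 0 < d ->
  often_above a A d -> exists2 p, (k <= p)%N & A p.
Proof.
move=> d0 dA; have d20 : 0 < d / 2 by rewrite divr_gt0.
have /(often_above_shift k) /(_ dA) : d / 2 < d by lra.
by case/(often_above_nonempty d20) => p Ap; exists (p + k)%N; rewrite ?leq_addl.
Qed.

End ClassS.

(** * Intersections of translates *)

(** Either at most [n] of the sets contain [p], or [n] distinct ones do and then
    some injection witnesses it, while the left-hand side never exceeds
    [M]. *)
Lemma sum_indic_le_injections (R : realType) (n M : nat) (J : 'I_M -> set nat) (p : nat) :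
  \sum_(j < M) \1_(J j) p <=
  n%:R + M%:R * \sum_(t : {ffun 'I_n -> 'I_M} | injectiveb t)
    \1_[set q | forall l : 'I_n, J (t l) q] p :> R.
Proof.
pose H := [set j : 'I_M | `[< J j p >] ]%SET.
have -> : \sum_(j < M) \1_(J j) p = #|H|%:R :> R.
  rewrite -sumr_const [RHS]big_mkcond /=; apply: eq_bigr => j _.
  by rewrite indicE01 /H inE.
set s := \sum_(t | _) _.
have s0 : 0 <= s by rewrite sumr_ge0 // => t _; rewrite indicE.
have [Hn|nH] := leqP #|H| n.
  by rewrite (@le_trans _ _ n%:R) ?ler_nat // lerDl mulr_ge0.
pose t : {ffun 'I_n -> 'I_M} := [ffun l => enum_val (widen_ord (ltnW nH) l)].
have injt : injectiveb t.
  apply/injectiveP => l l'; rewrite !ffunE => /enum_val_inj /(congr1 val) /=.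
  exact: val_inj.
have s1 : 1 <= s.
  rewrite /s (bigD1 t) //= indicE01 asboolT.
    by rewrite lerDl sumr_ge0 // => u _; rewrite indicE.
  by move=> l; rewrite ffunE; have := enum_valP (widen_ord (ltnW nH) l);
    rewrite [in X in _ \in X -> _]/H inE => /asboolP.
have HM : #|H|%:R <= M%:R :> R by rewrite ler_nat -[leqRHS]card_ord max_card.
rewrite (le_trans HM) //; apply: (@le_trans _ _ (M%:R * s)).
  by rewrite ler_peMr.
by rewrite lerDr.
Qed.

(** Pigeonhole over a finite family: if no member were often above [d], all of
    them would be at most [d] from some common rank on. *)
Lemma often_above_exists (R : realType) (a : nat -> R) (I : finType) (P : pred I)
    (B : I -> set nat) (d : R) :
  (forall N0, exists N, exists i,
    [/\ (N0 <= N)%N, P i & d < weighted_mean a \1_(B i) N]) ->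
  exists2 i, P i & often_above a (B i) d.
Proof.
move=> h; apply: contrapT => nex.
have {nex} bnd i : exists N0, P i -> forall N, (N0 <= N)%N ->
    weighted_mean a \1_(B i) N <= d.
  apply: contrapT => ni; apply: nex; exists i.
    by apply: contrapT => nPi; apply: ni; exists 0%N.
  move=> N0; apply: contrapT => nN; apply: ni; exists N0 => _ N leN.
  by rewrite leNgt; apply/negP => dN; apply: nN; exists N.
have [N0 N0P] := choice bnd.
have [N [i [leN Pi]]] := h (\max_(i : I) N0 i)%N.
by rewrite ltNge N0P // (leq_trans _ leN) // leq_bigmax.
Qed.

(** The [M] translates of [A] have almost the same mean as [A] at a large time,
    so the number of translates containing a random point has mean about
    [M * d]. When this is well above [n], a positive proportion of points lies
    in [n] translates at once, and one of the finitely many choices of [n]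
    translates receives a fixed share of it. The numbers [M] and [c] do not
    depend on the translations [s]. *)
Lemma often_above_translates (R : realType) (a : nat -> R) (A : set nat) (d : R)
    (n : nat) :
  class_S a -> 0 < d -> often_above a A d ->
  exists M : nat, exists2 c : R, 0 < c & forall s : nat -> nat,
    exists2 t : {ffun 'I_n -> 'I_M}, injective t &
      often_above a [set p | forall l : 'I_n, A (p + s (t l))%N] c.
Proof.
move=> Sa d0 dA; have [a_ge0 _ _ _ _] := Sa.
pose M := (Num.truncn (4 * n%:R / d)).+1.
have Mn : 4 * n%:R < M%:R * d.
  by rewrite -ltr_pdivrMr //; exact: truncnS_gt.
pose C := #|{ffun 'I_n -> 'I_M}|%:R : R.
have C0 : 0 <= C by rewrite ler0n.
exists M, (d / (4 * (C + 1))); first by rewrite divr_gt0 // mulr_gt0 //; lra.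
set c := d / _ => s.
suff [t /injectiveP injt tP] : exists2 t : {ffun 'I_n -> 'I_M}, injectiveb t &
    often_above a [set p | forall l : 'I_n, A (p + s (t l))%N] c by exists t.
apply: often_above_exists => N0.
(* At large times all translates have mean above [d / 2]. *)
have near_s : \forall N \near \oo, forall (j : 'I_M) (B : set nat),
    weighted_mean a \1_B N < weighted_mean a \1_[set p | B (p + s j)%N] N + d / 2.
  by apply: filter_forall => j; apply: weighted_mean_shift_near => //; lra.
have [N1 _ N1P] := near_s.
have [N2 _ N2P] := psum_gt0_near Sa.
have [N [leN dN]] := dA (maxn N0 (maxn N1 N2)).
move: leN; rewrite !geq_max => /and3P[N0N N1N N2N].
have S0 : 0 < \sum_(j < N.+1) a j by apply: N2P => /=; exact: leqW.
have mean_cst (r : R) : weighted_mean a (fun=> r) N = r.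
  by rewrite /weighted_mean -mulr_suml mulrAC mulfV ?mul1r // gt_eqF.
pose B (t : {ffun 'I_n -> 'I_M}) := [set p | forall l : 'I_n, A (p + s (t l))%N].
exists N; apply: contrapT => nt.
have Bc (t : {ffun 'I_n -> 'I_M}) : injectiveb t -> weighted_mean a \1_(B t) N <= c.
  by move=> injt; rewrite leNgt; apply/negP => ct; apply: nt; exists t.
have lower : M%:R * (d / 2) <= \sum_(j < M) weighted_mean a \1_[set p | A (p + s j)%N] N.
  rewrite mulr_natl -[in leLHS](card_ord M) -sumr_const; apply: ler_sum => j _.
  by have := N1P _ N1N j A; lra.
have upper : \sum_(j < M) weighted_mean a \1_[set p | A (p + s j)%N] N <=
    n%:R + M%:R * \sum_(t : {ffun 'I_n -> 'I_M} | injectiveb t) weighted_mean a \1_(B t) N.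
  rewrite -!weighted_mean_sum.
  apply: (le_trans (le_weighted_mean a_ge0 (fun p _ =>
    sum_indic_le_injections R n (fun j : 'I_M => [set p | A (p + s j)%N]) p))).
  rewrite /weighted_mean.
  under eq_bigr do rewrite mulrDr mulrCA.
  rewrite big_split /= mulrDl -mulr_sumr -mulrA lerD2r.
  by have := mean_cst n%:R; rewrite /weighted_mean => ->.
have sumc : \sum_(t : {ffun 'I_n -> 'I_M} | injectiveb t) weighted_mean a \1_(B t) N
    <= C * c.
  have c0 : 0 <= c by rewrite ltW // divr_gt0 // mulr_gt0 //; lra.
  apply: (@le_trans _ _ (\sum_(t : {ffun 'I_n -> 'I_M} | injectiveb t) c)).
    exact: ler_sum.
  rewrite sumr_const -mulr_natl ler_wpM2r // ler_nat max_card //.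
have Cc : C * c <= d / 4.
  rewrite /c mulrA ler_pdivrMr; last by lra.
  rewrite [leRHS](_ : _ = d * (C + 1)); last by rewrite mulrA divfK.
  by rewrite [leLHS]mulrC ler_wpM2l ?ltW //; lra.
have M0 : 0 < M%:R :> R by rewrite ltr0n.
have : M%:R * (d / 2) <= n%:R + M%:R * (d / 4).
  rewrite (le_trans lower) // (le_trans upper) // lerD2l.
  by apply: ler_wpM2l; [exact: ltW|exact: le_trans Cc].
lra.
Qed.

(** * Transitivity properties of the operator *)

Lemma open_forall_fin (X : topologicalType) (I : finType) (U : I -> set X) :
  (forall i, open (U i)) -> open [set y | forall i, U i y].
Proof.
move=> oU; rewrite openE => y Uy; apply: filter_forall => i.
by apply: open_nbhs_nbhs; split.
Qed.

Section Dynamics.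
Variables (R : realType) (a : nat -> R).
Hypothesis Sa : class_S a.
Variables (K : numFieldType) (X : normedModType K) (T : {linear X -> X}).
Hypothesis Tcont : continuous T.
Variable x : X.
Hypothesis x_UFHC : forall U : set X, open U -> U !=set0 ->
  exists2 d : R, 0 < d & often_above a [set p | U (iter p T x)] d.

Lemma iter_continuous p : continuous (iter p T).
Proof.
elim: p => [|p IHp] y; first exact: cvg_id.
by apply: continuous_comp; [exact: IHp|exact: Tcont].
Qed.

Lemma open_iter_preimage p (U : set X) : open U -> open [set y | U (iter p T y)].
Proof. by move=> oU; apply: open_comp => // y _; exact: iter_continuous. Qed.

Lemma iterD_linear p (u v : X) : iter p T (u + v) = iter p T u + iter p T v.
Proof. by elim: p => [//|p IHp] /=; rewrite IHp linearD. Qed.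

Lemma iter_linear0 p : iter p T 0 = 0.
Proof. by elim: p => [//|p IHp] /=; rewrite IHp linear0. Qed.

Lemma orbit_visits k (U : set X) : open U -> U !=set0 ->
  exists2 p, (k <= p)%N & U (iter p T x).
Proof.
move=> oU U0; have [d d0 dU] := x_UFHC oU U0.
exact: (often_above_unbounded Sa k d0 dU).
Qed.

Lemma orbit_visit (U : set X) :
  open U /\ U !=set0 -> exists p, U (iter p T x).
Proof. by case=> oU U0; have [p _ Up] := orbit_visits 0 oU U0; exists p. Qed.

(** The points whose iterates of orders [h i], for the values found so far, all
    lie in [O] form a neighborhood of [0], which the orbit of [x] enters before a
    late visit to [U]. The time between these two visits, less [m], can be taken
    as the next value of [h]: its gaps from the earlier values, increased by [m],
    are transit times from [O] to [U]. *)
Lemma gap_sequence (U O : set X) (m M : nat) : open U -> U !=set0 ->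
  open O -> O 0 ->
  exists h : nat -> nat, forall i j, (i < j < M)%N ->
    exists g, h j = (g + h i)%N /\
      exists2 o, O o & U (iter (g + m) T o).
Proof.
move=> oU U0 oO O0; elim: M => [|M [h hP]].
  by exists id => i j; rewrite ltn0 andbF.
have oO' : open [set y | forall i : 'I_M, O (iter (h i) T y)].
  by apply: open_forall_fin => i; exact: open_iter_preimage.
have [|p0 _ Op0] := orbit_visits 0 oO'.
  by exists 0 => i; rewrite iter_linear0.
(* [q] is late enough for the truncated subtractions below to be exact. *)
have [q leq Uq] := orbit_visits (p0 + m + \sum_(i < M) h i) oU U0.
exists (fun i => if i == M then (q - p0 - m)%N else h i) => i j /andP[ij].
rewrite ltnS leq_eqVlt => /predU1P[jM|jM]; last first.
  by rewrite !ltn_eqF ?(ltn_trans ij) //; apply: hP; rewrite ij.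
rewrite {}jM eqxx in ij *; rewrite ltn_eqF //.
have hi : (h i <= \sum_(i < M) h i)%N.
  by rewrite (bigD1 (Ordinal ij)) //= leq_addr.
exists (q - p0 - m - h i)%N; split; first by lia.
exists (iter (h i) T (iter p0 T x)); first exact: (Op0 (Ordinal ij)).
by rewrite -!iterD (_ : (_ + _ = q)%N) //; lia.
Qed.

(** Let [W] be the set of points of [U] that lie in [O] after [m] steps. Two of
    the translates by a gap sequence [h] of the visit times to [W] meet,
    so some gap [g] of [h] is a difference of visit times to [W]; then
    [k = g + m] takes a point of [U] into [O], and the choice of [h] makes it
    take a point of [O] into [U]. *)
Lemma return_through_zero (U O : set X) : open U -> U x -> open O -> O 0 ->
  exists k, (exists2 u, U u & O (iter k T u)) /\ (exists2 o, O o & U (iter k T o)).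
Proof.
move=> oU Ux oO O0.
have [m _ Om] : exists2 m, (0 <= m)%N & O (iter m T x).
  by apply: orbit_visits => //; exists 0.
pose W := U `&` [set y | O (iter m T y)].
have oW : open W by apply: openI => //; exact: open_iter_preimage.
have [d d0 dW] := x_UFHC oW (ex_intro _ x (conj Ux Om)).
have [M [c c0 hM]] := often_above_translates 2 Sa d0 dW.
have [h hP] := gap_sequence m M oU (ex_intro _ x Ux) oO O0.
have [t injt /(often_above_nonempty c0) [p pW]] := hM h.
have [i [j [ij [Wi Wj]]]] : exists i j : 'I_M, (i < j)%N /\
    (W (iter (p + h i) T x) /\ W (iter (p + h j) T x)).
  have : t ord0 != t ord_max by apply/eqP => /injt.
  rewrite neq_ltn => /orP[lt01|lt10].
    by exists (t ord0), (t ord_max); split; last (split; exact: pW).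
  by exists (t ord_max), (t ord0); split; last (split; exact: pW).
have [|g [hj [z Oz Uz]]] := hP i j; first by rewrite ij ltn_ord.
exists (g + m)%N; split; last by exists z.
exists (iter (p + h i) T x); first by case: Wi.
case: Wj => _ /=; rewrite -!iterD.
by rewrite (_ : m + (p + h j) = g + m + (p + h i))%N //; lia.
Qed.

(** Weak mixing of every order. The hypercyclic vector [x] visits all [U i] and
    all [V i], at times [m i] and [q i]. If [u] is near [x] with
    [iter k T u] near [0], and [z] is near [0] with [iter k T z] near [x], then
    [iter (m i) T u + iter (q i) T z] is near [iter (m i) T x] and is taken by
    [iter k T] near [iter (q i) T x]. One [k] thus serves all [i]; this is
    where linearity enters. *)
Lemma common_transit_time (I : finType) (U V : I -> set X) :
  (forall i, open (U i) /\ U i !=set0) -> (forall i, open (V i) /\ V i !=set0) ->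
  exists k, forall i, exists2 u, U i u & V i (iter k T u).
Proof.
move=> hU hV.
have [m mP] := choice (fun i => orbit_visit (hU i)).
have [q qP] := choice (fun i => orbit_visit (hV i)).
pose f i (z : X * X) := iter (m i) T z.1 + iter (q i) T z.2.
have fcont i : continuous (f i).
  move=> z; apply: cvgD.
    by apply: continuous_comp; [exact: cvg_fst|exact: iter_continuous].
  by apply: continuous_comp; [exact: cvg_snd|exact: iter_continuous].
have f_open (W : I -> set X) : (forall i, open (W i) /\ W i !=set0) ->
    open [set z : X * X | forall i, W i (f i z)].
  move=> hW; apply: open_forall_fin => i; apply: open_comp => [z _|].
    exact: fcont.
  by case: (hW i).
have Unear : nbhs (x, 0 : X) [set z | forall i, U i (f i z)].
  apply: open_nbhs_nbhs; split; first exact: f_open.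
  by move=> i; rewrite /f /= iter_linear0 addr0.
have Vnear : nbhs (0 : X, x) [set z | forall i, V i (f i z)].
  apply: open_nbhs_nbhs; split; first exact: f_open.
  by move=> i; rewrite /f /= iter_linear0 add0r.
case: Unear => -[G1 E1] /= [G1x E10] UP.
case: Vnear => -[E2 G2] /= [E20 G2x] VP.
have [k [[u Gu Ou] [z Oz Gz]]] : exists k,
    (exists2 u, (G1 `&` G2)° u & (E1 `&` E2)° (iter k T u)) /\
    (exists2 o, (E1 `&` E2)° o & (G1 `&` G2)° (iter k T o)).
  by apply: return_through_zero; [exact: open_interior|exact: filterI|
    exact: open_interior|exact: filterI].
move: Gu Ou Oz Gz => /interior_subset[Gu _] /interior_subset[_ Ou].
move=> /interior_subset[zO _] /interior_subset[_ Gz].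
exists k => i; exists (f i (u, z)); first exact: (UP (u, z) (conj Gu zO)).
have := VP (iter k T u, iter k T z) (conj Ou Gz) i.
by rewrite /f /= iterD_linear -!iterD ![(k + _)%N]addnC.
Qed.

(** All [n ^ M] itineraries through the sets [V l] are realized along the same
    times [s]; each new time is a common transit time from the finitely many
    sets of points that follow a given itinerary so far. *)
Lemma colored_times (n M : nat) (V : 'I_n -> set X) :
  (forall l, open (V l) /\ V l !=set0) ->
  exists s : nat -> nat, forall c : nat -> 'I_n,
    exists y, forall j, (j < M)%N -> V (c j) (iter (s j) T y).
Proof.
move=> hV; elim: M => [|M [s sP]]; first by exists id => c; exists x.
pose U (i : {ffun 'I_M -> 'I_n} * 'I_n) :=
  [set y | forall j : 'I_M, V (i.1 j) (iter (s j) T y)].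
have hU i : open (U i) /\ U i !=set0.
  split.
    apply: open_forall_fin => j; apply: open_iter_preimage.
    by case: (hV (i.1 j)).
  have [y yP] := sP (fun j => oapp i.1 i.2 (insub j)).
  by exists y => j; have := yP j (ltn_ord j); rewrite valK.
have [k kP] := common_transit_time hU (fun i => hV i.2).
exists (fun j => if j == M then k else s j) => c.
have [y Uy Vy] := kP ([ffun j : 'I_M => c j], c M).
exists y => j; rewrite ltnS leq_eqVlt => /predU1P[->|jM]; first by rewrite eqxx.
by rewrite ltn_eqF //; have := Uy (Ordinal jM); rewrite ffunE.
Qed.

(** The quantitative heart of the proof: [c] depends on [U] only. Visits to the
    sets [U l] are visits of [x] to a single open set [W], up to the delays
    [m l]. Coordinate [l] starts at the point of the orbit of [x] of time
    [m l + s (t l) + i], so that all coordinates [l] are in [U l] at time [p] as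
    soon as [p + i] belongs to all translates by [s (t l)] of the visit times
    to [W]; a choice of [t] that makes this frequent is given by
    [often_above_translates]. As [t] is known only after [s], the times [s]
    must allow every assignment of the sets [V l] to them. *)
Lemma product_often_above (n : nat) (U : 'I_n -> set X) :
  (forall l, open (U l) /\ U l !=set0) ->
  exists2 c : R, 0 < c & forall V : 'I_n -> set X,
    (forall l, open (V l) /\ V l !=set0) ->
    exists2 y : 'I_n -> X, (forall l, V l (y l)) &
      often_above a [set p | forall l, U l (iter p T (y l))] c.
Proof.
move=> hU.
have [m mP] := choice (fun l => orbit_visit (hU l)).
pose W := [set y | forall l, U l (iter (m l) T y)].
have oW : open W.
  by apply: open_forall_fin => l; apply: open_iter_preimage; case: (hU l).
have [d d0 dW] := x_UFHC oW (ex_intro _ x mP).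
have [M [c c0 cP]] := often_above_translates n Sa d0 dW.
exists (c / 2) => [|V hV]; first by rewrite divr_gt0.
(* Points whose iterate of order [m l], the one seen by coordinate [l], is in
   [V l]. *)
pose V' l := [set y | V l (iter (m l) T y)].
have hV' l : open (V' l) /\ V' l !=set0.
  have [oV V0] := hV l; split; first exact: open_iter_preimage.
  have [p lep Vp] := orbit_visits (m l) oV V0.
  by exists (iter (p - m l) T x); rewrite /V' /= -iterD subnKC.
have [s sP] := colored_times M hV'.
have [t injt tW] := cP s.
pose G := [set y | forall l, V' l (iter (s (t l)) T y)].
have oG : open G.
  by apply: open_forall_fin => l; apply: open_iter_preimage; case: (hV' l).
have G0 : G !=set0.
  case: (posnP n) => [n0|n_gt0].
    by exists x => l; have := ltn_ord l; rewrite [X in (_ < X)%N]n0.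
  (* The time [s (t l)] is assigned to [V' l]; the default ordinal fills the times
     outside the range of [t]. *)
  have [y yP] := sP (fun j => odflt (Ordinal n_gt0) [pick l | val (t l) == j]).
  exists y => l; have := yP (t l) (ltn_ord _).
  case: pickP => [l' /eqP /val_inj /injt -> //|/(_ l)]; by rewrite eqxx.
have [i _ Gi] := orbit_visits 0 oG G0.
exists (fun l => iter (m l + s (t l) + i) T x) => [l|].
  by rewrite -addnA !iterD; exact: (Gi l).
have /(often_above_shift Sa i) /(_ tW) : c / 2 < c by lra.
set A := (X in often_above a X _); set B := (X in _ -> often_above a X _).
suff AB : A `<=` B.
  move=> h N0; have [N [leN cN]] := h N0; exists N; split => //.
  apply: (lt_le_trans cN); apply: le_weighted_mean_indic; first by case: Sa.
  by move=> j _; exact: AB.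
move=> p Ap l; have := Ap l l; rewrite /W /= -!iterD.
by congr (U l (iter _ T x)); lia.
Qed.

End Dynamics.

(** * Category argument in a finite power of the space *)

(** An archimedean property, stated for [K] so that the real and the complex
    case are treated together. *)
Definition small_inverses (K : numFieldType) :=
  forall e : K, 0 < e -> exists m : nat, m.+1%:R^-1 < e.

Lemma real_or_complex_small_inverses (R : realType) (K : numFieldType) :
  real_or_complex R K -> small_inverses K.
Proof.
have smallR (e : R) : 0 < e -> exists m : nat, m.+1%:R^-1 < e.
  move=> e0; exists (Num.truncn e^-1).
  by rewrite -[ltRHS]invrK ltf_pV2 ?posrE ?invr_gt0 // truncnS_gt.
case=> -> //= e; rewrite ltcE /= => /andP[/eqP e_im e_re].
have [m me] := smallR _ e_re; exists m.
have -> : m.+1%:R^-1 = (m.+1%:R^-1)%:C%C :> R[i] by rewrite fmorphV rmorph_nat.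
by rewrite ltcE /= me andbT e_im.
Qed.

Section Baire.
Variables (K : numFieldType) (X : completeNormedModType K).
Hypothesis hK : small_inverses K.

(** The limit of the centers is only in the closure of each ball, hence the
    doubled radii. *)
Lemma nested_balls (c : nat -> X) (r : nat -> K) :
  (forall k, 0 < r k) -> (forall k, r k.+1 < k.+1%:R^-1) ->
  (forall k, ball (c k.+1) (r k.+1) `<=` ball (c k) (r k)) ->
  exists y, forall k, ball (c k) (r k + r k) y.
Proof.
move=> r0 rk nest.
have nested k m : (k <= m)%N -> ball (c m) (r m) `<=` ball (c k) (r k).
  elim: m => [|m IHm]; first by rewrite leqn0 => /eqP ->.
  rewrite leq_eqVlt => /predU1P[-> //|km].
  exact: (subset_trans (nest m)) (IHm km).
have inball k m : (k <= m)%N -> ball (c k) (r k) (c m).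
  by move=> km; apply: (nested k m km); exact: ballxx.
have c_cvg : cvg (c @ \oo).
  apply/cauchy_cvgP; apply: cauchy_exP => e e0.
  have [k ke] := hK e0.
  exists (c k.+1); exists k.+1 => // m /= km.
  apply: le_ball (inball _ _ km); rewrite ltW // (lt_trans (rk k)) //.
exists (lim (c @ \oo)) => k.
have : \forall m \near \oo, ball (lim (c @ \oo)) (r k) (c m).
  by apply: c_cvg; exact: nbhsx_ballx.
case=> m _ mP.
apply: (@ball_triangle _ _ (c (maxn k m))); first exact: inball (leq_maxl _ _).
by apply: ball_sym; apply: mP; rewrite /= leq_maxr.
Qed.

Lemma open_contains_ball2 (V : set X) (e : K) : open V -> V !=set0 -> 0 < e ->
  exists y r, [/\ 0 < r, r < e & ball y (r + r) `<=` V].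
Proof.
move=> oV [y Vy] e0; have /nbhs_ballP [d /= d0 dV] : nbhs y V.
  exact: open_nbhs_nbhs.
have d20 : 0 < d / 2 by rewrite divr_gt0.
have e20 : 0 < e / 2 by rewrite divr_gt0.
have e2e : e / 2 < e by rewrite ltr_pdivrMr // ltr_pMr // ltr1n.
have ball2 r : r <= d / 2 -> ball y (r + r) `<=` V.
  move=> rd; apply: subset_trans dV; apply: le_ball.
  by rewrite [leRHS]splitr lerD.
have [de|ed] := real_leP (gtr0_real d20) (gtr0_real e20).
  by exists y, (d / 2); split; [|exact: le_lt_trans e2e|exact: ball2].
by exists y, (e / 2); split; [| |apply: ball2; exact: ltW].
Qed.

(** Baire's theorem in the power of order [n], with boxes in place of a metric on
    the power: a condition that can be forced on a smaller box inside any box,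
    for each of countably many conditions, holds at some point. *)
Lemma Baire_power (n : nat) (J : countType) (D : J -> set ('I_n -> X)) :
  (forall j (V : 'I_n -> set X), (forall l, open (V l) /\ V l !=set0) ->
    exists V' : 'I_n -> set X,
      [/\ forall l, open (V' l) /\ V' l !=set0, forall l, V' l `<=` V l &
      forall y, (forall l, V' l (y l)) -> D j y]) ->
  exists y, forall j, D j y.
Proof.
move=> hD.
pose E k := if unpickle k is Some j then D j else setT.
pose good (cr : 'I_n -> X * K) := forall l, 0 < (cr l).2.
pose refines k (cr cr' : 'I_n -> X * K) :=
  [/\ good cr', forall l, (cr' l).2 < k.+1%:R^-1,
     forall l, ball (cr' l).1 (cr' l).2 `<=` ball (cr l).1 (cr l).2 &
     forall y, (forall l, ball (cr' l).1 ((cr' l).2 + (cr' l).2) (y l)) -> E k y].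
have step (kcr : nat * ('I_n -> X * K)) : exists cr' : 'I_n -> X * K,
    good kcr.2 -> refines kcr.1 kcr.2 cr'.
  case: kcr => k cr /=.
  case: (pselect (good cr)) => [r0|]; last by exists cr.
  pose V l := ball (cr l).1 (cr l).2.
  have hV l : open (V l) /\ V l !=set0.
    by split; [exact: ball_open|exists (cr l).1; exact/ballxx/r0].
  have [V' [hV' VV' EV']] : exists V' : 'I_n -> set X,
      [/\ forall l, open (V' l) /\ V' l !=set0, forall l, V' l `<=` V l &
      forall y, (forall l, V' l (y l)) -> E k y].
    by rewrite /E; case: (unpickle k) => [j|]; [exact: hD|
      exists V; split => // l; exact: subset_refl].
  have k0 : 0 < k.+1%:R^-1 :> K by rewrite invr_gt0 ltr0n.
  have pick_ball l : exists cr' : X * K,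
      [/\ 0 < cr'.2, cr'.2 < k.+1%:R^-1 & ball cr'.1 (cr'.2 + cr'.2) `<=` V' l].
    have [oV' V'0] := hV' l.
    by have [y [r h]] := open_contains_ball2 oV' V'0 k0; exists (y, r).
  have [cr' cr'P] := choice pick_ball.
  exists cr' => _; split => [l|l|l|y yP].
  - by case: (cr'P l).
  - by case: (cr'P l).
  - have [r'0 _ sub] := cr'P l; apply: subset_trans (VV' l).
    by apply: subset_trans sub; apply: le_ball; rewrite lerDl ltW.
  - by apply: EV' => l; have [_ _ sub] := cr'P l; apply: sub.
have [next nextP] := choice step.
pose fix cr (k : nat) : 'I_n -> X * K :=
  if k is k'.+1 then next (k', cr k') else fun=> (0, 1).
have cr_good k : good (cr k).
  elim: k => [l|k IHk] /=; first exact: ltr01.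
  by case: (nextP (k, cr k) IHk).
have cr_refines k : refines k (cr k) (cr k.+1) by exact: (nextP (k, cr k) (cr_good k)).
have lim_l l : exists y, forall k, ball (cr k l).1 ((cr k l).2 + (cr k l).2) y.
  apply: (nested_balls (c := fun k => (cr k l).1) (r := fun k => (cr k l).2)) => k.
  - exact: cr_good.
  - by case: (cr_refines k).
  - by case: (cr_refines k).
have [y yP] := choice lim_l.
exists y => j; have [_ _ _ /(_ y)] := cr_refines (pickle j).
by rewrite /E pickleK; apply => l; exact: yP.
Qed.

End Baire.

Lemma iter_product_operator (X : Type) (n : nat) (T : X -> X) p
    (y : {ptws 'I_n -> X}) l :
  iter p (product_operator (n := n) T) y l = iter p T (y l).
Proof. by elim: p => [//|p IHp] /=; rewrite /product_operator IHp. Qed.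

(** Boxes around [y] generate a filter that converges to [y] coordinatewise,
    so it is finer than the neighborhoods of [y]. *)
Lemma ptws_open_box (K : numFieldType) (X : normedModType K) (n : nat)
    (G : set {ptws 'I_n -> X}) (y : {ptws 'I_n -> X}) : open G -> G y ->
  exists r : 'I_n -> K, (forall l, 0 < r l) /\
    forall z : {ptws 'I_n -> X}, (forall l, ball (y l) (r l) (z l)) -> G z.
Proof.
move=> oG Gy.
pose box (r : 'I_n -> K) := [set z : 'I_n -> X | forall l, ball (y l) (r l) (z l)].
pose F := filter_from [set r : 'I_n -> K | forall l, 0 < r l] box.
have FF : Filter F.
  apply: filter_from_filter; first by exists (fun=> 1) => l; exact: ltr01.
  move=> r s r0 s0.
  exists (fun l => if r l <= s l then r l else s l) => [l|z zP].
    by case: ifP => _; [exact: r0|exact: s0].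
  split=> l; have := zP l;
    have [rs|sr] := real_leP (gtr0_real (r0 l)) (gtr0_real (s0 l)) => //.
  - by apply: le_ball; exact: ltW.
  - by apply: le_ball.
have : F --> y.
  apply/cvg_sup => l A.
  have /= -> := @nbhsE (initial_topology (fun f : 'I_n -> X => f l)) y.
  case=> B [[C oC <-] /= Cy] BA.
  have /nbhs_ballP [e /= e0 eC] : nbhs (y l) C by apply: open_nbhs_nbhs.
  by exists (fun=> e) => // z zP; apply: BA; apply: eC; exact: zP.
have nG : nbhs y G by apply: open_nbhs_nbhs.
by move=> /(_ G nG) [r r0 rG]; exists r; split => // z zP; exact: rG.
Qed.

Unset Implicit Arguments.
Unset Strict Implicit.

Theorem corollary2p11 (R : realType) (K : numFieldType)
    (hK : real_or_complex R K) (X : completeNormedModType K)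
    (T : {linear X -> X}) (a : nat -> R) :
  separable X ->
  infinite_dimensional X ->
  bounded_near T (nbhs (0 : X)) ->
  class_S a ->
  U_frequently_hypercyclic a T ->
  forall n : nat, (1 <= n)%N ->
    U_frequently_hypercyclic a (product_operator (n := n) T).
Proof.
move=> _ _ /bounded_linear_continuous Tcont Sa [x xU] n _.
have x_UFHC (U : set X) : open U -> U !=set0 ->
    exists2 d : R, 0 < d & often_above a [set p | U (iter p T x)] d.
  by move=> oU U0; apply/upper_density_gt0P; exact: xU.
have hKs := real_or_complex_small_inverses hK.
(* A countable family of boxes, centered at orbit points, that contains a box
   inside every non-empty open set of the product. *)
pose U (i : {ffun 'I_n -> nat * nat}) (l : 'I_n) : set X :=
  ball (iter (i l).1 T x) (i l).2.+1%:R^-1.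
have hU i l : open (U i l) /\ U i l !=set0.
  split; first exact: ball_open.
  by eexists; apply: ballxx; rewrite invr_gt0 ltr0n.
have densU i : exists c : R, 0 < c /\ forall V : 'I_n -> set X,
    (forall l, open (V l) /\ V l !=set0) ->
    exists2 y : 'I_n -> X, (forall l, V l (y l)) &
      often_above a [set p | forall l, U i l (iter p T (y l))] c.
  by have [c c0 cP] := product_often_above Sa Tcont x_UFHC (hU i); exists c.
have [c cP] := choice densU.
(* One condition for each box and each lower bound for the time at which the
   proportion of visits is large. *)
pose D (j : {ffun 'I_n -> nat * nat} * nat) := [set y : 'I_n -> X |
  exists2 N, (j.2 <= N)%N &
    c j.1 < weighted_mean a \1_[set p | forall l, U j.1 l (iter p T (y l))] N].
have [y yP] : exists y, forall j, D j y.
  apply: (Baire_power hKs) => -[i N0] V hV.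
  have [_ /(_ V hV) [z Vz zi]] := cP i.
  have [N [leN cN]] := zi N0.
  (* Points sharing the visits of [z] up to time [N]. *)
  pose follow l := [set w : X | forall p : 'I_N.+1,
    U i l (iter p T (z l)) -> U i l (iter p T w)].
  exists (fun l => V l `&` follow l); split => [l|l|w wP].
  - split; last by exists (z l); split; [exact: Vz|].
    apply: openI; first by case: (hV l).
    apply: open_forall_fin => p; rewrite -[X in open X]/[set w | _].
    have [Uz|nUz] := pselect (U i l (iter p T (z l))).
      rewrite (_ : [set w | _] = [set w | U i l (iter p T w)]).
        by apply: (open_iter_preimage Tcont); case: (hU i l).
      by apply/seteqP; split => w /=; [apply|].
    rewrite (_ : [set w | _] = setT); first exact: openT.
    by apply/seteqP; split => // w _ /nUz.
  - by move=> w [].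
  - exists N => //; apply: (lt_le_trans cN).
    apply: le_weighted_mean_indic => [|p leN' zp l]; first by case: Sa.
    have [_ wl] := wP l.
    by apply: (wl (@Ordinal N.+1 p leN')); exact: zp.
exists y => G oG [z Gz]; apply/upper_density_gt0P.
have [r [r0 rG]] := ptws_open_box oG Gz.
have near_orbit l : exists km : nat * nat,
    ball (iter km.1 T x) km.2.+1%:R^-1 `<=` ball (z l) (r l).
  have r20 : 0 < r l / 2 by rewrite divr_gt0.
  have [m mr] := hKs _ r20.
  have m0 : 0 < m.+1%:R^-1 :> K by rewrite invr_gt0 ltr0n.
  have [k kP] : exists k, ball (z l) m.+1%:R^-1 (iter k T x).
    apply: (orbit_visit Sa x_UFHC); split; first exact: ball_open.
    by exists (z l); exact: ballxx.
  exists (k, m) => w /= kw; apply: (le_ball (e1 := m.+1%:R^-1 + m.+1%:R^-1)).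
    by rewrite [leRHS]splitr lerD // ltW.
  exact: ball_triangle kw.
have [km kmP] := choice near_orbit.
pose i : {ffun 'I_n -> nat * nat} := [ffun l => km l].
have [ci0 _] := cP i; exists (c i) => // N0.
have [N leN cN] := yP (i, N0); exists N; split => //.
apply: (lt_le_trans cN).
apply: le_weighted_mean_indic => [|p _ ip]; first by case: Sa.
apply: rG => l; rewrite iter_product_operator.
by apply: kmP; have := ip l; rewrite /U ffunE.
Qed.
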